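(* Let $\mathcal S$ be a binary digital $(0,1)$-sequence. Let $\mathcal S^{\mathrm{scr}}$ denote either its matrix-scrambled version with a fixed digital shift or its linearly scrambled version, and let $P_N^{\mathrm{scr}}$ be the point set of the first $N$ points of $\mathcal S^{\mathrm{scr}}$ (the assertions hold in both cases). For every $\varepsilon>0$, set $m_r=\lceil r^{1+\varepsilon}\rceil$ and $N_r=2^{m_r}$. Then, almost surely, $$ \rho_\infty(P_{N_r}^{\mathrm{scr}})\ge\frac{r^\varepsilon}{8(\log(2+r))^2} $$ for all sufficiently large $r$. Thus the mesh ratio diverges along the sparse subsequence $(N_r)_{r\ge1}$, and both scrambled sequences are almost surely not quasi-uniform.
   Context: Binary digital sequence in dimension one: given a generating matrix $C\in\mathbb F_2^{\mathbb N\times\mathbb N}$, for $n=n_0+2n_1+4n_2+\cdots$ (finitely many nonzero binary digits) the $n$-th point is $\sum_{r\ge1}y_r2^{-r}$, where $(y_r)_{r\ge1}=C(n_0,n_1,\dots)^\top$ is its specified output digit vector. Membership of a digital point in a dyadic interval is determined by these digits. It is a $(0,1)$-sequence in base 2 if for all $k,m\ge0$, every dyadic interval $[a2^{-m},(a+1)2^{-m})$, $0\le a<2^m$, contains exactly one of the points with indices $k2^m\le n<(k+1)2^m$. Scrambling: let $L$ be a random infinite lower triangular matrix over $\mathbb F_2$ with ones on the diagonal and independent uniform entries below the diagonal. Given a digital shift $\boldsymbol\delta\in\mathbb F_2^{\mathbb N}$, replace the output digit vector $\boldsymbol y$ of every point by $L\boldsymbol y\oplus\boldsymbol\delta$ ($\oplus$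 is digitwise addition in $\mathbb F_2$). With $\boldsymbol\delta$ deterministic this is matrix scrambling (probability over $L$ only); if all digits of $\boldsymbol\delta$ are independent uniform and independent of $L$, it is linear scrambling (probability over $L$ and $\boldsymbol\delta$). The same $L$ (and the same shift) is used for all points of the sequence. For an $N$-point multiset $P=(x_n)$ in $[0,1]$ with $N\ge2$: $h_\infty(P)=\sup_{z\in[0,1]}\min_{n}|z-x_n|$, $q_\infty(P)=\frac12\min_{n<n'}|x_n-x_{n'}|$, and the mesh ratio is $\rho_\infty(P)=h_\infty(P)/q_\infty(P)$ ($=\infty$ if $q_\infty(P)=0$). A sequence is quasi-uniform if the supremum over $N\ge2$ of $\rho_\infty$ of its first $N$ points is finite. *)

(* Defs.v *)
From HB Require Import structures.
From mathcomp Require Import all_boot all_order all_algebra finmap.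
From mathcomp Require Import all_classical all_reals all_analysis.

Set Implicit Arguments.
Unset Strict Implicit.
Unset Printing Implicit Defensive.

Import Order.TTheory GRing.Theory Num.Theory.
Import numFieldNormedType.Exports.

Local Open Scope classical_set_scope.
Local Open Scope ring_scope.

(* Digit vectors are indexed from 0: [y r] is the digit of weight 2^-(r+1). *)
Definition digits := nat -> 'F_2.

Definition bit (n j : nat) : 'F_2 := (odd (n %/ 2 ^ j))%:R.

(* The product C (n_0, n_1, ...)^T is a finite sum: n has no nonzero binary
   digit at a position j > n, since n < 2 ^ n. *)
Definition output_digits (C : nat -> nat -> 'F_2) (n : nat) : digits :=
  fun r => \sum_(j < n.+1) C r j * bit n j.

Definition digital_point (R : realType) (y : digits) : R :=
  limn (series (fun r => (val (y r))%:R / 2 ^+ r.+1 : R)).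

(* Membership of the digital point y in [a 2^-m, (a+1) 2^-m), as determined by
   its digits (not by its real value, which y may share with another digit
   vector): the first m digits are those of a / 2^m. *)
Definition in_dyadic (y : digits) (m a : nat) : Prop :=
  (\sum_(r < m) val (y r) * 2 ^ (m - r.+1))%N = a.

Definition digital_01_sequence (C : nat -> nat -> 'F_2) : Prop :=
  forall k m a : nat, (a < 2 ^ m)%N ->
    exists! n : nat, (k * 2 ^ m <= n < k.+1 * 2 ^ m)%N /\
                     in_dyadic (output_digits C n) m a.

(* L y (+) delta for a lower triangular L, whose row r is supported on
   the columns j <= r. *)
Definition scramble (L : nat -> nat -> 'F_2) (delta y : digits) : digits :=
  fun r => \sum_(j < r.+1) L r j * y j + delta r.

Definition scrambled_sequence (R : realType) (C L : nat -> nat -> 'F_2)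
    (delta : digits) : nat -> R :=
  fun n => digital_point R (scramble L delta (output_digits C n)).

(* The subfamily (X i), i in D, consists of independent random variables
   uniform on F_2, which carries the discrete sigma-algebra. *)
Definition iid_uniform_bits d (Omega : measurableType d) (R : realType)
    (P : probability Omega R) (I : choiceType) (D : set I)
    (X : I -> Omega -> 'F_2) : Prop :=
  [/\ forall i (A : set 'F_2), D i -> measurable (X i @^-1` A),
      forall i (b : 'F_2), D i -> P (X i @^-1` [set b]) = (2^-1)%:E &
      forall (J : {fset I}) (A : I -> set 'F_2), [set` J] `<=` D ->
        P (\bigcap_(i in [set` J]) (X i @^-1` A i)) =
        (\prod_(i <- J) P (X i @^-1` A i))%E].

Definition unit_lower_triangular (L : nat -> nat -> 'F_2) : Prop :=
  (forall i, L i i = 1) /\ (forall i j, (i < j)%N -> L i j = 0).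

Definition below_diagonal : set (nat * nat) := [set p | (p.2 < p.1)%N].

Definition matrix_scrambling d (Omega : measurableType d) (R : realType)
    (P : probability Omega R) (L : Omega -> nat -> nat -> 'F_2)
    (delta : Omega -> digits) : Prop :=
  [/\ forall w, unit_lower_triangular (L w),
      iid_uniform_bits P below_diagonal (fun p w => L w p.1 p.2) &
      exists delta0 : digits, forall w, delta w = delta0].

(* The entries of L below the diagonal and the digits of delta form a single
   family of independent uniform bits. *)
Definition linear_scrambling d (Omega : measurableType d) (R : realType)
    (P : probability Omega R) (L : Omega -> nat -> nat -> 'F_2)
    (delta : Omega -> digits) : Prop :=
  (forall w, unit_lower_triangular (L w)) /\
  iid_uniform_bits P
    [set s : (nat * nat) + nat | if s is inl p then below_diagonal p else True]
    (fun s w => match s with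
                | inl p => L w p.1 p.2
                | inr r => delta w r
                end).

(* In the next two definitions the default value of the minimum is one of the
   values it ranges over, for N >= 1 and N >= 2 respectively. *)
Definition covering_radius (R : realType) (x : nat -> R) (N : nat) : R :=
  sup [set \big[Num.min/`|z - x 0%N|]_(n < N) `|z - x n| | z in `[0, 1]].

Definition separation_radius (R : realType) (x : nat -> R) (N : nat) : R :=
  2^-1 * \big[Num.min/`|x 0%N - x 1%N|]_(p : 'I_N * 'I_N | (p.1 < p.2)%N)
           `|x p.1 - x p.2|.

Definition mesh_ratio (R : realType) (x : nat -> R) (N : nat) : \bar R :=
  if separation_radius x N == 0 then +oo%E
  else (covering_radius x N / separation_radius x N)%:E.

Definition quasi_uniform (R : realType) (x : nat -> R) : Prop :=
  (ereal_sup [set mesh_ratio x N | N in [set N | (2 <= N)%N]] < +oo)%E.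

Definition sparse_index (R : realType) (eps : R) (r : nat) : nat :=
  2 ^ `|Num.ceil (r%:R `^ (1 + eps))|%N.

(* Main.v *)
Require Import Defs.
From HB Require Import structures.
From mathcomp Require Import all_boot all_order all_algebra finmap.
From mathcomp Require Import all_classical all_reals all_analysis.
From mathcomp Require Import zify ring lra.

(** Fix [m = p + T] and look [k] digits beyond the first [m].  By the
    (0,1)-property the first [2 ^ m] points realise every vector [y] of [m]
    leading output digits, and the [k] digits that follow are [K y] for a fixed
    matrix [K].  Scrambling with the corner [[Lm, 0], [G, Lk]] of [L] and the
    shift digits [d], [e] replaces these by [u = Lm y + d] and by
    [H (u - d) + e], where [H = (G + Lk K) Lm^-1].  The block [G] is uniform
    and independent of [Lm] and [Lk], hence [H] is uniform too.

    Two leading vectors [u = (z, 0, 1, ..., 1)] and [u' = (z, 1, 0, ..., 0)]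
    encode consecutive integers; if the next [k] digits are all [1] after [u]
    and all [0] after [u'], the two points are within [2 / 2 ^ (m + k)] of each
    other ([digital_point_carry]).  With [v_s = u' - u], where [s] is the
    position of the carry among the last [T] leading digits, this asks for
    [H v_s = (1, ..., 1)] and for [H (u - d) + e = (1, ..., 1)].  The vectors
    [v_s] are linearly independent, so the first equations are independent
    events of probability [2 ^- k], and all [T] of them fail with probability
    [(1 - 2 ^- k) ^ T].  The second equation still has the [p] digits [z] free,
    so it is solvable once the first [p] columns of [H] have full row rank,
    which fails with probability at most [2 ^ k / 2 ^ p].  Neither event
    mentions the shift: both kinds of scrambling are covered at once, and all
    that is used of [L] is that its finite corners are uniformly distributed
    ([uniform_corners]).

    Along the sparse subsequence one takes [2 ^ k] of order [r ^ eps],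
    [q = r / 2] rounded down and [T = q * 2 ^ k], which leaves [p >= T]; the
    failure probability is then at most [3 / 2 ^ q] ([large_mesh_ratio]), which
    is summable, and Borel-Cantelli applies.  Outside the exceptional events
    the separation radius is at most [2 ^- (m + k)], while any [N] points have
    covering radius at least [1 / (2 N)]; hence the mesh ratio is at least
    [2 ^ k / 2 >= r ^ eps / 4] ([ae_mesh_ratio_ge]), which implies the
    logarithmic bound, the divergence and the failure of quasi-uniformity. *)

Import Order.TTheory GRing.Theory Num.Theory.
Import numFieldNormedType.Exports.

Local Open Scope classical_set_scope.
Local Open Scope ring_scope.

(** * Counting matrices over the two-element field *)

Lemma F2P (x : 'F_2) : x = 0 \/ x = 1.
Proof.
by case: x => [[|[|x]] i //]; [left | right]; apply: val_inj.
Qed.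

Lemma card_mxF2 (a b : nat) : #|{: 'M['F_2]_(a, b)}| = (2 ^ (a * b))%N.
Proof. by rewrite card_mx card_Fp. Qed.

Lemma leq_card_union {S I : finType} (A : pred S) (B : I -> pred S) :
  (forall x, A x -> exists i, B i x) -> (#|A| <= \sum_i #|B i|)%N.
Proof.
move=> AB; rewrite -sum1_card.
under [leqRHS]eq_bigr => i _ do rewrite -sum1_card big_mkcond.
rewrite exchange_big big_mkcond leq_sum// => x _ /=.
case: ifPn => // /AB[i Bi].
by rewrite (bigD1 i)//= (_ : x \in B i) ?leq_addr.
Qed.

Lemma bernoulli_expn (a n : nat) : (a ^ n + n * a ^ n.-1 <= a.+1 ^ n)%N.
Proof.
elim: n => [|n IH]; first by rewrite !expn0 mul0n.
rewrite [leqRHS]expnS; apply: leq_trans (leq_mul (leqnn a.+1) IH).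
rewrite /=; case: n {IH} => [|n] /=; first by rewrite !expnS !expn0; lia.
by rewrite !expnS; nia.
Qed.

(** The bound [(1 - 1/K) ^ K <= 1/2] without denominators. *)
Lemma double_expn_pred (K : nat) : (0 < K)%N ->
  (2 * K.-1 ^ K <= K ^ K)%N.
Proof.
case: K => // a _ /=.
apply: leq_trans (bernoulli_expn a a.+1).
by rewrite /= mul2n -addnn leq_add2l expnS leq_mul2r leqnSn orbT.
Qed.

(** The columns of [stair T] are the differences [v_s] of the leading digits
    across a carry at position [s], cut to the last [T] leading digits. *)
Definition stair (T : nat) : 'M['F_2]_T := \matrix_(i, s) (s <= i)%N%:R.

Lemma stair_unit (T : nat) : stair T \in unitmx.
Proof.
rewrite unitmxE det_trig.
  by rewrite big1 ?unitr1// => i _; rewrite mxE leqnn.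
by apply/is_trig_mxP => i j ij; rewrite mxE leqNgt ij.
Qed.

(** The two conditions on [H] that produce a pair of close points: full row
    rank of the first [p] columns leaves enough freedom in the digits before
    the carry, and some carry vector is sent to [(1, ..., 1)]. *)
Definition carrying {k p T : nat} (H : 'M['F_2]_(k, p + T)) :=
  row_free (lsubmx H) &&
  [exists s, col s (rsubmx H *m stair T) == const_mx 1%R].

(** The columns are chosen independently, each among all but one vector. *)
Lemma card_no_ones_col (k T : nat) :
  (#|[pred Q : 'M['F_2]_(k, T) | [forall s, col s Q != const_mx 1%R]]|
    <= (2 ^ k).-1 ^ T)%N.
Proof.
have -> : ((2 ^ k).-1 ^ T)%N =
    #|ffun_on (predC1 (const_mx 1%R : 'cV['F_2]_k)) : pred {ffun 'I_T -> _}|.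
  by rewrite card_ffun_on cardC1 card_mxF2 muln1 card_ord.
pose f (Q : 'M['F_2]_(k, T)) := [ffun s => col s Q].
have fI : injective f.
  move=> Q Q' /ffunP QQ'; apply/matrixP => i j.
  by have /colP/(_ i) := QQ' j; rewrite !ffunE !mxE.
rewrite -(card_imset _ fI); apply/subset_leq_card/fintype.subsetP => _ /imsetP[Q Qn ->].
apply/ffun_onP => s; rewrite ffunE.
by move: Qn; rewrite !inE => /forallP.
Qed.

(** Where [a] has a nonzero entry [j], adding an arbitrary row [r] to row [j]
    of [W] changes [a *m W] by [r]: the translates of the kernel are disjoint. *)
Lemma card_left_kernel {k p : nat} (a : 'rV['F_2]_k) : a != 0 ->
  (#|[pred W : 'M['F_2]_(k, p) | a *m W == 0%R]| * 2 ^ p <= 2 ^ (k * p))%N.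
Proof.
move=> /rV0Pn[j aj].
have {aj}aj : a 0 j = 1 by case: (F2P (a 0 j)) aj => ->.
(* On the kernel, [x.2] is recovered from [f x] as [a *m f x]. *)
pose f (x : 'M['F_2]_(k, p) * 'rV['F_2]_p) := x.1 + delta_mx j 0 *m x.2.
pose A := [predX [pred W : 'M['F_2]_(k, p) | a *m W == 0] & predT (T := 'rV['F_2]_p)].
have af W r : a *m W = 0 -> a *m f (W, r) = r.
  move=> aW; rewrite mulmxDr aW add0r mulmxA -colE.
  suff -> : col j a = 1%:M by rewrite mul1mx.
  by apply/rowP => i; rewrite !mxE ord1 aj.
have fI : {in A &, injective f}.
  move=> [W r] [W' r']; rewrite !inE /= !andbT => /eqP aW /eqP aW' ff.
  have rr : r = r' by rewrite -(af W r aW) ff af.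
  by move: ff; rewrite /f /= rr => /addIr ->.
have -> : (2 ^ p)%N = #|predT (T := 'rV['F_2]_p)| by rewrite card_mxF2 mul1n.
by rewrite -cardX -card_mxF2 -(card_in_imset fI) max_card.
Qed.

(** A union bound over the nonzero vectors of the left kernel. *)
Lemma card_not_row_free (k p : nat) :
  (#|[pred W : 'M['F_2]_(k, p) | ~~ row_free W]| * 2 ^ p
    <= 2 ^ k * 2 ^ (k * p))%N.
Proof.
pose B (a : 'rV['F_2]_k) := [pred W : 'M['F_2]_(k, p) | (a != 0%R) && (a *m W == 0)].
have /leq_card_union le : forall W : 'M['F_2]_(k, p), ~~ row_free W ->
    exists a, B a W.
  move=> W; rewrite -kermx_eq0 => /rowV0Pn[a /sub_kermxP aW a0].
  by exists a; rewrite /= a0 aW eqxx.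
apply: leq_trans (leq_mul le (leqnn _)) _; rewrite big_distrl /=.
apply: (@leq_trans (\sum_(a : 'rV['F_2]_k) 2 ^ (k * p))%N); last first.
  by rewrite sum_nat_const card_mxF2 mul1n.
apply: leq_sum => a _; have [->|a0] := eqVneq a 0.
  by rewrite eq_card0 ?mul0n// => W; rewrite !inE eqxx.
by rewrite (eq_card (B := [pred W | a *m W == 0])) ?card_left_kernel.
Qed.

(** Right multiplication by the invertible matrix [stair T] turns the carry
    vectors into unit vectors, so that [card_no_ones_col] applies. *)
Lemma card_not_carrying (k p T : nat) :
  (#|[pred H : 'M['F_2]_(k, p + T) | ~~ carrying H]|
   <= #|[pred W : 'M['F_2]_(k, p) | ~~ row_free W]| * 2 ^ (k * T)
      + 2 ^ (k * p) * (2 ^ k).-1 ^ T)%N.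
Proof.
pose A1 := [pred W : 'M['F_2]_(k, p) | ~~ row_free W].
pose A2 := [pred Q : 'M['F_2]_(k, T) | [forall s, col s (Q *m stair T) != const_mx 1%R]].
pose f (H : 'M['F_2]_(k, p + T)) := (lsubmx H, rsubmx H).
have fI : injective f.
  by move=> H H' [e1 e2]; rewrite -(hsubmxK H) e1 e2 hsubmxK.
have cA2 : (#|A2| <= (2 ^ k).-1 ^ T)%N.
  apply: leq_trans (card_no_ones_col k T).
  rewrite -(card_imset _ (can_inj (mulmxK (stair_unit T)))).
  apply/subset_leq_card/fintype.subsetP => _ /imsetP[Q AQ ->].
  by move: AQ; rewrite !inE.
pose B1 := [predX A1 & predT (T := 'M['F_2]_(k, T))].
pose B2 := [predX predT (T := 'M['F_2]_(k, p)) & A2].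
have -> : (2 ^ (k * T))%N = #|predT (T := 'M['F_2]_(k, T))| by rewrite card_mxF2.
apply: (@leq_trans (#|B1| + #|B2|)%N); last first.
  by rewrite !cardX leq_add2l card_mxF2 leq_mul2l cA2 orbT.
rewrite -(card_imset _ fI); apply: (@leq_trans #|predU B1 B2|%N); last first.
  by rewrite -cardUI leq_addr.
apply/subset_leq_card/fintype.subsetP => _ /imsetP[H AH ->].
move: AH; rewrite !inE /= andbT negb_and negb_exists; case/orP => [->//|/forallP h].
by apply/orP; right; apply/forallP.
Qed.

(** With [T = q * 2 ^ k] carry positions the proportion of matrices without
    carry is at most [(1 - 2 ^- k) ^ T <= 2 ^- q], and that of rank-deficient
    ones at most [2 ^ k / 2 ^ p], which is at most [2 / 2 ^ q] for [q > 0]; the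
    bound is trivial for [q = 0]. *)
Lemma card_not_carrying_le (k p q : nat) : (q * 2 ^ k <= p)%N ->
  (#|[pred H : 'M['F_2]_(k, p + q * 2 ^ k) | ~~ carrying H]| * 2 ^ q
   <= 3 * 2 ^ (k * (p + q * 2 ^ k)))%N.
Proof.
case: (posnP q) => [-> _|q0 pq].
  rewrite expn0 muln1 -card_mxF2; apply: leq_trans (max_card _) _.
  by rewrite leq_pmull.
set T := (q * 2 ^ k)%N in pq *.
have := card_not_row_free k p.
have := card_not_carrying k p T.
set D := #|[pred W : 'M['F_2]_(k, p) | _]| => cH cD.
have c1 : (D * 2 ^ q <= 2 * 2 ^ (k * p))%N.
  rewrite -(@leq_pmul2r (2 ^ p)) ?expn_gt0// mulnAC.
  apply: leq_trans (leq_mul cD (leqnn _)) _.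
  rewrite mulnAC [leqRHS]mulnAC leq_mul2r -expnD -expnS leq_exp2l//.
  apply/orP; right; have := ltn_expl k (ltnSn 1).
  by rewrite /T in pq *; move: pq q0; set K := (2 ^ k)%N; nia.
have c2 : ((2 ^ k).-1 ^ T * 2 ^ q <= 2 ^ (k * T))%N.
  rewrite (expnM 2 k) /T [(q * _)%N]mulnC; have := expn_gt0 2 k.
  set K := (2 ^ k)%N => K0; rewrite !(expnM _ K) -expnMn leq_exp2r//.
  by rewrite mulnC double_expn_pred.
apply: leq_trans (leq_mul cH (leqnn _)) _.
rewrite mulnDr expnD mulnDl.
move: c1 c2; set a := (2 ^ (k * p))%N; set b := (2 ^ (k * T))%N.
set e := (_ ^ T)%N; set Q := (2 ^ q)%N => c1 c2.
have := leq_mul c1 (leqnn b); have := leq_mul (leqnn a) c2; lia.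
Qed.

(** * Uniformity of the reduced block *)

(** Double counting: if for every point of [U] at most a proportion [y / x] of
    its translates lies in [S], then at most that proportion of [U] does,
    because each translation permutes [U]. *)
Lemma card_average {A B : finType} (U S : pred A) (act : B -> A -> A)
    (x y : nat) :
  (0 < #|B|)%N -> (forall b, injective (act b)) ->
  (forall b a, U (act b a) = U a) ->
  (forall a, U a -> (#|[pred b | S (act b a)]| * x <= y * #|B|)%N) ->
  (#|[pred a | U a && S a]| * x <= y * #|U|)%N.
Proof.
move=> B0 actI Uact avg; rewrite -(leq_pmul2l B0).
have -> : (#|B| * (#|[pred a | U a && S a]| * x)
    = \sum_(a | U a) #|[pred b | S (act b a)]| * x)%N.
  rewrite mulnA -big_distrl /=; congr (_ * _)%N.
  under eq_bigr => a _ do rewrite -sum1_card big_mkcond.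
  rewrite exchange_big /= -sum_nat_const; apply: eq_bigr => b _.
  rewrite -sum1_card big_mkcond /= (reindex_inj (actI b)) /= [RHS]big_mkcond.
  by apply: eq_bigr => a _; rewrite !inE Uact; case: (U a).
apply: (@leq_trans (\sum_(a | U a) y * #|B|)%N).
  exact: leq_sum.
by rewrite sum_nat_const mulnC [(y * _)%N]mulnC mulnA [(_ * y)%N]mulnC.
Qed.

Definition unitri {n : nat} : pred 'M['F_2]_n :=
  fun X => [forall i : 'I_n, forall j : 'I_n, (i <= j)%N ==> (X i j == (i == j)%:R)].

Lemma unitriP {n : nat} (X : 'M['F_2]_n) :
  reflect (forall i j : 'I_n, (i <= j)%N -> X i j = (i == j)%:R) (unitri X).
Proof.
apply: (iffP forallP) => [h i j ij|h i].
  by have /forallP/(_ j)/implyP/(_ ij)/eqP := h i.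
by apply/forallP => j; apply/implyP => ij; rewrite h.
Qed.

(** The matrix [H] through which the scrambled leading digits determine the
    [k] scrambled digits that follow, up to the shift. *)
Definition reduced_block {m k : nat} (K : 'M['F_2]_(k, m))
    (X : 'M['F_2]_(m + k)) : 'M['F_2]_(k, m) :=
  (dlsubmx X + drsubmx X *m K) *m invmx (ulsubmx X).

Lemma unitri_ulsubmx {m k : nat} (X : 'M['F_2]_(m + k)) :
  unitri X -> ulsubmx X \in unitmx.
Proof.
move/unitriP => hX; rewrite unitmxE det_trig.
  by rewrite big1 ?unitr1// => i _; rewrite !mxE hX// eqxx.
apply/is_trig_mxP => i j ij; rewrite !mxE hX; last exact: ltnW.
by rewrite (inj_eq (@lshift_inj _ _)) -val_eqE ltn_eqF.
Qed.

Lemma unitri_ursubmx {m k : nat} (X : 'M['F_2]_(m + k)) :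
  unitri X -> ursubmx X = 0.
Proof.
move/unitriP => hX; apply/matrixP => i j; rewrite !mxE hX.
  by rewrite eq_lrshift.
by rewrite /= (leq_trans (ltnW (ltn_ord i)))// leq_addr.
Qed.

(** Adding [G] to the lower left block translates [reduced_block K] by
    [G *m invmx (ulsubmx X)], and so runs through all matrices exactly once;
    the count for a uniform matrix transfers by [card_average]. *)
Lemma card_unitri_not_carrying (k p q : nat)
    (K : 'M['F_2]_(k, p + q * 2 ^ k)) : (q * 2 ^ k <= p)%N ->
  (#|[pred X | unitri X && ~~ carrying (reduced_block K X)]| * 2 ^ q
    <= 3 * #|@unitri (p + q * 2 ^ k + k)|)%N.
Proof.
move=> pq; set m := (p + q * 2 ^ k)%N in K *.
pose act (G : 'M['F_2]_(k, m)) (X : 'M['F_2]_(m + k)) :=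
  X + block_mx 0 0 G 0.
apply: (@card_average _ _ _ [pred X | ~~ carrying (reduced_block K X)] act).
- by rewrite card_mxF2 expn_gt0.
- by move=> G; exact: addIr.
- move=> G X.
  have G0 (i j : 'I_(m + k)) : (i <= j)%N -> block_mx 0 0 G 0 i j = 0.
    rewrite mxE; case: splitP => i' ei; rewrite mxE; case: splitP => j' ej;
    rewrite ?mxE// ei ej => ij; have := ltn_ord j'; lia.
  by apply/unitriP/unitriP => h i j ij; have := h i j ij;
    rewrite /act mxE G0// addr0.
- move=> X uX; have Lu := unitri_ulsubmx _ uX.
  rewrite card_mxF2; apply: leq_trans (card_not_carrying_le k p q pq).
  rewrite leq_mul2r; apply/orP; right.
  pose f G := reduced_block K (act G X).
  have fI : injective f.
    move=> G G'; rewrite /f /reduced_block /act.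
    rewrite -[X]submxK !add_block_mx !block_mxKul !block_mxKdl !block_mxKdr.
    rewrite !addr0 => /(congr1 (mulmx^~ (ulsubmx X))).
    by rewrite !mulmxKV// => /addIr/addrI.
  pose S := [pred G | ~~ carrying (f G)].
  have fS : f @: S \subset [pred H | ~~ carrying H].
    apply/fintype.subsetP => _ /imsetP[G AG ->].
    by rewrite inE; rewrite inE in AG.
  by have := subset_leq_card fS; rewrite (card_imset S fI).
Qed.

(** * Digits of a scrambled digital sequence *)

Lemma big_ord_trunc (F : nat -> 'F_2) (a b : nat) : (a <= b)%N ->
  (forall j, (a <= j)%N -> F j = 0) -> \sum_(j < a) F j = \sum_(j < b) F j.
Proof.
move=> ab F0; rewrite (big_ord_widen _ F ab) [RHS](bigID (fun j : 'I_b => (j < a)%N)) /=.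
by rewrite [X in _ + X]big1 ?addr0// => i; rewrite -leqNgt => /F0.
Qed.

Definition dyadic_index (y : digits) (m : nat) : nat :=
  \sum_(r < m) val (y r) * 2 ^ (m - r.+1).

Lemma dyadic_indexS (y : digits) (m : nat) :
  dyadic_index y m.+1 = (2 * dyadic_index y m + val (y m))%N.
Proof.
rewrite /dyadic_index big_ord_recr /= subnn expn0 muln1 big_distrr /=.
congr (_ + _)%N; apply: eq_bigr => i _.
by rewrite mulnCA -expnS subnSK.
Qed.

Lemma dyadic_index_lt (y : digits) (m : nat) : (dyadic_index y m < 2 ^ m)%N.
Proof.
elim: m => [|m IH]; first by rewrite /dyadic_index big_ord0.
rewrite dyadic_indexS; have : (val (y m) < 2)%N by exact: ltn_ord.
by rewrite expnS; lia.
Qed.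

Lemma dyadic_index_inj (y y' : digits) (m : nat) :
  dyadic_index y m = dyadic_index y' m ->
  forall r, (r < m)%N -> y r = y' r.
Proof.
elim: m => // m IH; rewrite !dyadic_indexS => e.
have [e1 e2] : dyadic_index y m = dyadic_index y' m /\ val (y m) = val (y' m).
  have : (val (y m) < 2)%N by exact: ltn_ord.
  have : (val (y' m) < 2)%N by exact: ltn_ord.
  by move: e; move: (val (y m)) (val (y' m)) => a b; lia.
move=> r; rewrite ltnS leq_eqVlt => /orP[/eqP->|rm].
  exact: val_inj.
exact: IH.
Qed.

Lemma output_digits_trunc (C : nat -> nat -> 'F_2) (n N r : nat) :
  (n < 2 ^ N)%N -> output_digits C n r = \sum_(j < N) C r j * bit n j.
Proof.
move=> nN; have bit0 j : (n < 2 ^ j)%N -> C r j * bit n j = 0.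
  by move=> nj; rewrite /bit divn_small// mulr0.
rewrite /output_digits.
rewrite (big_ord_trunc (fun j => C r j * bit n j) _ _ (leq_maxl n.+1 N)).
  rewrite -(big_ord_trunc (fun j => C r j * bit n j) _ _ (leq_maxr n.+1 N))//.
  by move=> j Nj; rewrite bit0// (leq_trans nN)// leq_exp2l.
move=> j nj; rewrite bit0// (leq_ltn_trans (ltnW nj))//.
exact: ltn_expl.
Qed.

(** The (0,1)-property makes the map from index bits to leading output digits
    surjective, hence invertible as it is linear; the next digits are linear in
    the index bits, hence in the leading digits. *)
Lemma digital_01_sequence_net (C : nat -> nat -> 'F_2) (m k : nat) :
  digital_01_sequence C ->
  exists K : 'M['F_2]_(k, m), forall y : 'cV['F_2]_m,
    exists2 n : nat, (n < 2 ^ m)%N &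
      forall i : 'I_(m + k), output_digits C n i = col_mx y (K *m y) i 0.
Proof.
move=> hC.
pose M : 'M['F_2]_(m + k, m) := \matrix_(i, j) C i j.
pose b n : 'cV['F_2]_m := \col_j bit n j.
have outM n i : (n < 2 ^ m)%N -> output_digits C n (val i) = (M *m b n) i 0.
  move=> nm; rewrite (output_digits_trunc C n m)// mxE.
  by apply: eq_bigr => j _; rewrite !mxE.
have surj (y : 'cV['F_2]_m) : exists2 n, (n < 2 ^ m)%N & usubmx M *m b n = y.
  pose Y : digits := fun r => if insub r is Some i then y i 0 else 0.
  have [n [[/andP[_]]]] := hC 0 m _ (dyadic_index_lt Y m).
  rewrite mul1n => nm out _; exists n => //; apply/colP => i.
  rewrite mul_usub_mx [LHS]mxE -outM//= (dyadic_index_inj _ _ _ out)//.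
  by rewrite /Y valK.
have uM : usubmx M \in unitmx.
  have /boolp.choice[B BE] : forall j : 'I_m, exists c : 'cV['F_2]_m,
      usubmx M *m c = delta_mx j 0.
    by move=> j; have [n _ <-] := surj (delta_mx j 0); exists (b n).
  suff /mulmx1_unit[uM _] : usubmx M *m (\matrix_(i, j) B j i 0) = 1%:M.
    exact: uM.
  apply/matrixP => i j; have /colP/(_ i) := BE j.
  rewrite !mxE eqxx andbT => <-; apply: eq_bigr => l _.
  by rewrite !mxE.
exists (dsubmx M *m invmx (usubmx M)) => y.
have [n nm Mb] := surj y; exists n => // i.
rewrite outM// -{1}[M]vsubmxK mul_col_mx Mb; congr (col_mx _ _ _ _).
by rewrite -mulmxA -Mb mulKmx.
Qed.

Lemma scramble_trunc (L : nat -> nat -> 'F_2) (delta y : digits) (n : nat)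
    (i : 'I_n) : unit_lower_triangular L ->
  scramble L delta y i =
    (\matrix_(i < n, j < n) L i j *m \col_(j < n) y j) i 0 + delta i.
Proof.
move=> [_ L0]; congr (_ + _); rewrite mxE.
rewrite (big_ord_trunc (fun j => L i j * y j) _ _ (ltn_ord i)).
  by apply: eq_bigr => j _; rewrite !mxE.
by move=> j ij; rewrite L0// mul0r.
Qed.

Lemma unitri_trunc (L : nat -> nat -> 'F_2) (n : nat) :
  unit_lower_triangular L -> unitri (\matrix_(i < n, j < n) L i j).
Proof.
move=> [L1 L0]; apply/unitriP => i j; rewrite mxE leq_eqVlt.
case/orP => [/eqP/val_inj->|ij]; first by rewrite L1 eqxx.
by rewrite L0// -val_eqE ltn_eqF.
Qed.

(** The neighbours are [u = (z, 0, 1, ..., 1)] and [u + v_s], where [H v_s] is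
    the all-ones vector and [z] is found from a right inverse of the first [p]
    columns of [H].  The shift enters only the right-hand side of that linear
    system. *)
Lemma carrying_neighbours (C L : nat -> nat -> 'F_2) (delta : digits)
    (k p T : nat) (K : 'M['F_2]_(k, p + T)) :
  (forall y : 'cV['F_2]_(p + T), exists2 n : nat, (n < 2 ^ (p + T))%N &
     forall i : 'I_(p + T + k),
       output_digits C n i = col_mx y (K *m y) i 0) ->
  unit_lower_triangular L ->
  carrying (reduced_block K (\matrix_(i < p + T + k, j < p + T + k) L i j)) ->
  let x n := scramble L delta (output_digits C n) in
  exists n n' j, [/\ (n < 2 ^ (p + T))%N, (n' < 2 ^ (p + T))%N,
    (j < p + T)%N,
    forall i, (i < j)%N -> x n i = x n' i &
    [/\ x n j = 0, x n' j = 1,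
    forall i, (j < i < p + T + k)%N -> x n i = 1 &
    forall i, (j < i < p + T + k)%N -> x n' i = 0]].
Proof.
move=> net uL; set m := (p + T)%N in K net *; set X := \matrix_(i, j) _.
have uX : unitri X by exact: unitri_trunc.
have Lu := unitri_ulsubmx _ uX.
set H := reduced_block K X => /andP[/row_freeP[B WB] /existsP[s /eqP Hs]] x.
pose d : 'cV['F_2]_m := \col_i delta i.
pose e : 'cV['F_2]_k := \col_i delta (m + i)%N.
have point u : exists2 n, (n < 2 ^ m)%N & forall i : 'I_(m + k),
    x n i = col_mx u (H *m (u - d) + e) i 0.
  have [n nm out] := net (invmx (ulsubmx X) *m (u - d)); exists n => // i.
  rewrite /x scramble_trunc// -/X.
  have -> : \col_(j < m + k) output_digits C n j =
      col_mx (invmx (ulsubmx X) *m (u - d)) (K *m (invmx (ulsubmx X) *m (u - d))).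
    by apply/colP => j; rewrite mxE out.
  have -> : delta i = col_mx d e i 0.
    by rewrite mxE; case: splitP => i' ->; rewrite mxE.
  rewrite -{1}[X]submxK (unitri_ursubmx _ uX) mul_block_col mul0mx addr0.
  have -> : col_mx u (H *m (u - d) + e) = col_mx (u - d) (H *m (u - d)) + col_mx d e.
    by rewrite add_col_mx subrK.
  rewrite mulKVmx// [RHS]mxE; congr (col_mx _ _ _ _ + _).
  by rewrite /H /reduced_block -mulmxA mulmxDl mulmxA.
pose v : 'cV['F_2]_m := col_mx 0 (col s (stair T)).
have Hv : H *m v = const_mx 1.
  by rewrite -[H]hsubmxK mul_row_col mulmx0 add0r colE mulmxA -colE.
(* The part of [u] after [z]: zeros up to position [s], then ones. *)
pose w : 'cV['F_2]_m := col_mx 0 (\col_i (s < i)%N%:R).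
pose u : 'cV['F_2]_m :=
  col_mx (B *m (const_mx 1 - e - H *m (w - d))) 0 + w.
have Hu : H *m (u - d) + e = const_mx 1.
  rewrite -addrA mulmxDr -{1}[H]hsubmxK mul_row_col mulmx0 addr0.
  by rewrite mulmxA WB mul1mx subrK subrK.
have Huv : H *m (u + v - d) + e = 0.
  rewrite -addrA [v - d]addrC addrA mulmxDr Hv addrAC Hu.
  by apply/colP => i; rewrite !mxE; apply: val_inj.
have [n nm xn] := point u; have [n' n'm xn'] := point (u + v).
rewrite Hu in xn; rewrite Huv in xn'.
have sm : (p + s < m)%N by rewrite ltn_add2l.
exists n, n', (p + s)%N; split => //; last split.
- move=> i ij; have im : (i < m)%N by exact: ltn_trans sm.
  have := xn (lshift k (Ordinal im)); have := xn' (lshift k (Ordinal im)).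
  rewrite !col_mxEu => /= -> ->; rewrite [RHS]mxE -[LHS]addr0; congr +%R.
  rewrite mxE; case: splitP => i' /= ei; rewrite !mxE//.
  by move: ij; rewrite ei ltn_add2l [(s <= _)%N]leqNgt => ->.
- have := xn (lshift k (Ordinal sm)); rewrite col_mxEu => /= ->.
  rewrite mxE [w _ _]mxE mxE; case: splitP => i' /= ei; rewrite !mxE.
    by have := ltn_ord i'; rewrite -ei ltnNge leq_addr.
  by rewrite add0r -(addnI ei) ltnn.
- have := xn' (lshift k (Ordinal sm)); rewrite col_mxEu => /= ->.
  rewrite mxE [v _ _]mxE mxE [w _ _]mxE mxE.
  case: splitP => i' /= ei; rewrite !mxE.
    by have := ltn_ord i'; rewrite -ei ltnNge leq_addr.
  by rewrite add0r -(addnI ei) ltnn leqnn add0r.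
- move=> i /andP[ji im]; have := xn (Ordinal im); rewrite /= mxE => ->.
  case: splitP => i' /= ei; last by rewrite mxE.
  rewrite mxE [w _ _]mxE mxE; case: splitP => i2 /= ei2; rewrite !mxE.
    by have := ltn_ord i2; move: ji; rewrite ei ei2; lia.
  by move: ji; rewrite ei ei2 ltn_add2l => ->; rewrite add0r.
- move=> i /andP[ji im]; have := xn' (Ordinal im); rewrite /= mxE => ->.
  case: splitP => i' /= ei; last by rewrite mxE.
  rewrite mxE [v _ _]mxE mxE [w _ _]mxE mxE.
  case: splitP => i2 /= ei2; rewrite !mxE.
    by have := ltn_ord i2; move: ji; rewrite ei ei2; lia.
  move: ji; rewrite ei ei2 ltn_add2l => si; rewrite si (ltnW si) add0r.
  by apply: val_inj.
Qed.

(** * Geometry of the points *)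

(** Pigeonhole on the [N + 1] equally spaced points [i / N]: two of them have
    the same nearest sample point, so their distance is at most twice the
    covering radius. *)
Lemma covering_radius_ge (R : realType) (x : nat -> R) (N : nat) : (0 < N)%N ->
  (2 * N%:R)^-1 <= covering_radius x N.
Proof.
move=> N0; have N0R : 0 < N%:R :> R by rewrite ltr0n.
set h := covering_radius x N.
pose dist z := \big[Num.min/`|z - x 0%N|]_(n < N) `|z - x n|.
have hdist z : z \in `[0, 1] -> dist z <= h.
  move=> z01; apply: ub_le_sup; last by exists z.
  exists (1 + `|x 0%N|) => y [t /= + <-]; rewrite in_itv /= => /andP[t0 t1].
  apply: le_trans (bigmin_le_id _ _ _ _) _.
  by rewrite (le_trans (ler_normB _ _))// lerD2r ger0_norm.
have near z : z \in `[0, 1] -> exists n : 'I_N, `|z - x n| <= h.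
  move=> /hdist; apply: contraPP => /forallNP far; apply/negP; rewrite -ltNge.
  apply: lt_bigmin => [|n _]; last by rewrite ltNge; apply/negP/far.
  by rewrite ltNge; apply/negP/(far (Ordinal N0)).
have zP (i : 'I_N.+1) : (i%:R / N%:R : R) \in `[0, 1].
  rewrite in_itv /= divr_ge0//= ler_pdivrMr// mul1r ler_nat.
  by rewrite -ltnS ltn_ord.
have [f hf] := boolp.choice (fun i => near _ (zP i)).
have /injectivePn[i [j ij fij]] : ~~ injectiveb f.
  apply/negP => /injectiveP /leq_card.
  by rewrite !card_ord ltnn.
have d : `|(i%:R - j%:R) / N%:R| <= h + h.
  have := hf j; rewrite -fij distrC => hj.
  rewrite mulrBl -(subrKA (x (f i))).
  by apply: le_trans (ler_normD _ _) _; rewrite lerD.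
have d1 : 1 <= `|i%:R - j%:R : R|.
  move: ij; rewrite -val_eqE neq_ltn => /orP[] l.
    by rewrite distrC -natrB ?(ltnW l)// normr_nat ler1n subn_gt0.
  by rewrite -natrB ?(ltnW l)// normr_nat ler1n subn_gt0.
move: d; rewrite normrM normfV (gtr0_norm N0R) => d.
rewrite invfM ler_pdivrMl//.
rewrite -[_^-1]mul1r ler_pdivrMr//; move: d; rewrite ler_pdivrMr// => d.
by rewrite (le_trans d1)// (le_trans d)// -mulr2n mulr_natl.
Qed.

Lemma separation_radius_ge0 (R : realType) (x : nat -> R) (N : nat) :
  0 <= separation_radius x N.
Proof.
by rewrite mulr_ge0 ?invr_ge0//; apply: le_bigmin.
Qed.

Lemma separation_radius_le (R : realType) (x : nat -> R) (N n n' : nat) :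
  (n < N)%N -> (n' < N)%N -> n != n' ->
  separation_radius x N <= 2^-1 * `|x n - x n'|.
Proof.
wlog nn' : n n' / (n < n')%N.
  move=> wl nN n'N; rewrite neq_ltn => /orP[] l.
    by rewrite wl ?ltn_eqF.
  by rewrite distrC wl ?ltn_eqF.
move=> nN n'N _; rewrite ler_pM2l ?invr_gt0//.
exact: (bigmin_le_cond _ (j := (Ordinal nN, Ordinal n'N))).
Qed.

Lemma mesh_ratio_ge (R : realType) (x : nat -> R) (m k n n' : nat) :
  (n < 2 ^ m)%N -> (n' < 2 ^ m)%N -> n != n' ->
  `|x n - x n'| <= 2 / 2 ^+ (m + k) ->
  ((2 ^+ k / 2)%:E <= mesh_ratio x (2 ^ m))%E.
Proof.
move=> nm n'm nn' d; rewrite /mesh_ratio; case: ifPn => [_|q0].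
  by rewrite leey.
have q_gt0 : 0 < separation_radius x (2 ^ m).
  by rewrite lt_def q0 separation_radius_ge0.
rewrite lee_fin ler_pdivlMr//.
apply: le_trans (covering_radius_ge _ _ _ _); last by rewrite expn_gt0.
have q := separation_radius_le _ x _ _ _ nm n'm nn'.
have {}q : separation_radius x (2 ^ m) <= (2 ^+ (m + k))^-1.
  apply: le_trans q _; rewrite ler_pdivrMl//.
apply: le_trans (ler_wpM2l _ q) _.
  by rewrite divr_ge0// exprn_ge0.
rewrite natrX exprD !invfM mulrA [X in X <= _](_ : _ = 2^-1 * (2 ^+ m)^-1)//.
by field; rewrite !expf_neq0.
Qed.

Definition digit_prefix (R : realType) (y : digits) (n : nat) : R :=
  \sum_(r < n) (val (y r))%:R / 2 ^+ r.+1.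

Lemma digit_prefix_bounds (R : realType) (y : digits) (a b : nat) :
  (a <= b)%N ->
  digit_prefix R y a <= digit_prefix R y b <=
    digit_prefix R y a + (2 ^+ a)^-1 - (2 ^+ b)^-1.
Proof.
move=> /subnK <-; elim: (b - a)%N => [|n /andP[l u]].
  by rewrite add0n addrK lexx.
rewrite addSn /digit_prefix big_ord_recr /= -!/(digit_prefix _ _ _).
have e : (2 ^+ (n + a))^-1 = 2 * (2 ^+ (n + a).+1)^-1 :> R.
  by rewrite exprS invfM mulVKf.
rewrite e in u; set t := (2 ^+ (n + a).+1)^-1 in u *.
have t0 : 0 <= t by rewrite invr_ge0 exprn_ge0.
by case: (F2P (y (n + a)%N)) => -> /=; rewrite ?mul0r ?mul1r; lra.
Qed.

Lemma digital_point_bounds (R : realType) (y : digits) (n : nat) :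
  digit_prefix R y n <= digital_point R y <= digit_prefix R y n + (2 ^+ n)^-1.
Proof.
set u := series (fun r => (val (y r))%:R / 2 ^+ r.+1 : R).
have uE k : u k = digit_prefix R y k by rewrite /u /series /= big_mkord.
have cu : cvgn u.
  apply: nondecreasing_is_cvgn.
    by move=> a b ab; rewrite !uE; case/andP: (digit_prefix_bounds R y a b ab).
  exists 1 => _ [k _ <-]; rewrite uE.
  have /andP[_] := digit_prefix_bounds R y 0 k (leq0n k).
  rewrite {2}/digit_prefix big_ord0 add0r expr0 invr1 => /le_trans; apply.
  by rewrite gerBl invr_ge0 exprn_ge0.
rewrite /digital_point -/u; apply/andP; split.
  apply: limr_ge => //; exists n => // k /= nk; rewrite uE.
  by case/andP: (digit_prefix_bounds R y n k nk).
apply: limr_le => //; exists n => // k /= nk; rewrite uE.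
have /andP[_ /le_trans] := digit_prefix_bounds R y n k nk; apply.
by rewrite gerBl invr_ge0 exprn_ge0.
Qed.

(** The prefix of length [M] of [y'] exceeds that of [y] by exactly [2 ^- M],
    as [0 1 ... 1] and [1 0 ... 0] encode consecutive integers; the two tails
    contribute at most [2 ^- M] each. *)
Lemma digital_point_carry (R : realType) (y y' : digits) (j M : nat) :
  (j < M)%N -> (forall i, (i < j)%N -> y i = y' i) -> y j = 0 -> y' j = 1 ->
  (forall i, (j < i < M)%N -> y i = 1) ->
  (forall i, (j < i < M)%N -> y' i = 0) ->
  `|digital_point R y - digital_point R y'| <= 2 / 2 ^+ M.
Proof.
move=> jM eqj yj yj' y1 y0.
have pre : digit_prefix R y j = digit_prefix R y' j.
  by apply: eq_bigr => i _; rewrite eqj.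
have step k : (j + k < M)%N ->
    digit_prefix R y' (j + k).+1 = digit_prefix R y (j + k).+1 + (2 ^+ (j + k).+1)^-1.
  elim: k => [|k IH] kM; rewrite /digit_prefix !(big_ord_recr (_ + _)) /=.
    by rewrite -!/(digit_prefix _ _ _) addn0 pre yj yj' mul0r mul1r addr0.
  rewrite -!/(digit_prefix _ _ _) addnS IH; last by move: kM; rewrite addnS; apply: ltnW.
  rewrite y1 ?y0 /= ?mul0r ?mul1r ?addr0; [|lia..].
  have -> : (2 ^+ (j + k).+1)^-1 = 2 * (2 ^+ (j + k).+2)^-1 :> R.
    by rewrite (exprS _ (j + k).+1) invfM mulVKf.
  by ring.
have Mk : M = (j + (M - j.+1)).+1 by lia.
have {step} := step (M - j.+1)%N; rewrite -Mk.
move=> /(_ (leqnn M)) e.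
have := digital_point_bounds R y M; have := digital_point_bounds R y' M.
by rewrite e ler_norml => /andP[? ?] /andP[? ?]; apply/andP; split; lra.
Qed.

(** * Probability *)

(** All unit lower triangular values of the corner of size [n] are equally
    likely.  The common probability stays implicit: it is recovered from the
    total mass, which avoids counting the entries below the diagonal. *)
Definition uniform_corners {d} {Omega : measurableType d} {R : realType}
    (P : probability Omega R) (L : Omega -> nat -> nat -> 'F_2) : Prop :=
  forall n, exists c : R, forall Y : 'M['F_2]_n, unitri Y ->
    let A := [set w | \matrix_(i < n, j < n) L w i j = Y] in
    measurable A /\ P A = c%:E.

(** The maps [f] and [g] locate the entries below the diagonal inside a larger
    family of bits, since linear scrambling also draws the shift digits. *)
Lemma iid_uniform_corners {d} {Omega : measurableType d} {R : realType}
    (P : probability Omega R) (L : Omega -> nat -> nat -> 'F_2)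
    (I : choiceType) (D : set I) (X : I -> Omega -> 'F_2)
    (f : nat * nat -> I) (g : I -> nat * nat) :
  (forall w, unit_lower_triangular (L w)) -> iid_uniform_bits P D X ->
  cancel f g -> (forall p, (p.2 < p.1)%N -> D (f p)) ->
  (forall p w, X (f p) w = L w p.1 p.2) -> uniform_corners P L.
Proof.
move=> uL [mX uX iX] fK Df Xf n.
pose s := [seq p <- allpairs pair (iota 0 n) (iota 0 n) | (p.2 < p.1)%N].
have sP p : (p \in s) = [&& p.2 < p.1, p.1 < n & p.2 < n]%N.
  rewrite mem_filter; congr (_ && _).
  apply/allpairsP/andP => [[[a b]] /= [+ + ->]|[p1 p2]].
    by rewrite !mem_iota.
  by exists p; rewrite !mem_iota/= !add0n -surjective_pairing.
pose J := [fset f p | p in s]%fset.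
exists (\prod_(i <- J) 2^-1) => Y uY A.
pose y p := if insub p.1 is Some i then
  if insub p.2 is Some j then Y i j else 0 else 0.
have yE i j : y (nat_of_ord i, nat_of_ord j) = Y i j by rewrite /y !valK.
pose V i := [set y (g i)].
have JD : [set` J] `<=` D.
  move=> i /imfsetP[p /=]; rewrite sP => /andP[pp _] ->; exact: Df.
have -> : A = \bigcap_(i in [set` J]) (X i @^-1` V i).
  apply/seteqP; split => w.
    move=> wY i /imfsetP[p /=]; rewrite sP => /and3P[pp p1 p2] ->.
    rewrite /V /= fK Xf.
    by rewrite (surjective_pairing p) (yE (Ordinal p1) (Ordinal p2)) -wY mxE.
  move=> h; apply/matrixP => i j; rewrite mxE.
  have [ij|ji] := leqP i j.
    have [L1 L0] := uL w; rewrite (unitriP _ uY)//.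
    move: ij; rewrite leq_eqVlt => /orP[/eqP/val_inj->|ij].
      by rewrite L1 eqxx.
    by rewrite L0// -val_eqE ltn_eqF.
  have /h : f (nat_of_ord i, nat_of_ord j) \in J.
    by apply: in_imfset; rewrite /= sP /= ji !ltn_ord.
  by rewrite /V /= fK yE Xf.
split.
  apply: fin_bigcap_measurable => [|i /JD Di]; first exact: finite_fset.
  exact: mX.
rewrite iX// (big_morph EFin (@EFinM R) erefl); apply: eq_big_seq => i iJ.
by rewrite uX//; exact: JD.
Qed.

Lemma scrambling_uniform_corners {d} {Omega : measurableType d} {R : realType}
    (P : probability Omega R) (L : Omega -> nat -> nat -> 'F_2)
    (delta : Omega -> digits) :
  matrix_scrambling P L delta \/ linear_scrambling P L delta ->
  (forall w, unit_lower_triangular (L w)) /\ uniform_corners P L.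
Proof.
case=> [[uL iL _]|[uL iL]]; split => //.
  exact: (iid_uniform_corners P L _ _ _ id id uL iL).
pose g (s : (nat * nat) + nat) := if s is inl p then p else (0, 0)%N.
exact: (iid_uniform_corners P L _ _ _ inl g uL iL).
Qed.

Lemma uniform_corners_prob {d} {Omega : measurableType d} {R : realType}
    {P : probability Omega R} {L : Omega -> nat -> nat -> 'F_2} (n : nat) :
  (forall w, unit_lower_triangular (L w)) -> uniform_corners P L ->
  exists c : R, forall S : pred 'M['F_2]_n,
    let A := [set w | S (\matrix_(i < n, j < n) L w i j)] in
    measurable A /\ P A = (c *+ #|[pred Y | unitri Y && S Y]|)%:E.
Proof.
move=> uL /(_ n)[c hc]; exists c => S A.
pose F Y := [set w | \matrix_(i < n, j < n) L w i j = Y].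
pose J := [fset Y in [pred Y | unitri Y && S Y]]%fset.
have JP Y : (Y \in J) = unitri Y && S Y by rewrite in_fset.
have -> : A = \big[setU/set0]_(Y <- J) F Y.
  rewrite -bigcup_seq; apply/seteqP; split => [w Sw|w [Y /= YJ FY]].
    by eexists; last by []; rewrite /= JP Sw unitri_trunc.
  by move: YJ; rewrite JP -FY => /andP[].
split.
  rewrite big_seq; apply: bigsetU_measurable => Y; rewrite JP => /andP[uY _].
  by have [] := hc Y uY.
rewrite measure_fbigsetU.
- rewrite (eq_big_seq (fun=> c%:E)); last first.
    by move=> Y; rewrite JP => /andP[uY _]; have [] := hc Y uY.
  rewrite sumEFin big_const_seq count_predT iter_addr_0 -/J.
  rewrite -(card_finset (pred_of_simpl [pred Y | unitri Y && S Y])).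
  by congr (_ *+ #|` _|)%:E; apply/fsetP => Y; rewrite JP in_fset.
- by move=> Y; rewrite JP => /andP[uY _]; have [] := hc Y uY.
- by move=> Y Y' _ _ [w [<- <-]].
Qed.

Lemma uniform_corners_bound {d} {Omega : measurableType d} {R : realType}
    {P : probability Omega R} {L : Omega -> nat -> nat -> 'F_2} (n : nat)
    (S : pred 'M['F_2]_n) (a b : nat) :
  (forall w, unit_lower_triangular (L w)) -> uniform_corners P L ->
  (0 < a)%N ->
  (#|[pred Y | unitri Y && S Y]| * a <= b * #|@unitri n|)%N ->
  let A := [set w | S (\matrix_(i < n, j < n) L w i j)] in
  measurable A /\ (P A <= (b%:R / a%:R)%:E)%E.
Proof.
move=> uL cL a0 ab A; have [c hc] := uniform_corners_prob n uL cL.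
have [mA PA] := hc S; split => //; rewrite PA lee_fin.
have [_] := hc predT; rewrite (_ : [set w | _] = setT); last exact/seteqP.
rewrite probability_setT; set u := #|_|; case=> cu.
have u0 : (0 < u)%N by rewrite lt0n; apply/eqP => u0; move: cu; rewrite u0; lra.
have uE : #|@unitri n| = u by apply: eq_card => Y; rewrite !inE andbT.
rewrite uE in ab; rewrite ler_pdivlMr ?ltr0n//.
set v := #|_| in ab *; rewrite -(@ler_pM2r _ u%:R) ?ltr0n//.
have -> : c *+ v * a%:R * u%:R = (c *+ u) * (v * a)%:R.
  by rewrite natrM -[c *+ v]mulr_natr -[c *+ u]mulr_natr; ring.
by rewrite -cu mul1r -natrM ler_nat.
Qed.

(** The exceptional event depends on [L] alone, so the shift may be an
    arbitrary function of the outcome. *)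
Lemma large_mesh_ratio {d} {Omega : measurableType d} {R : realType}
    {P : probability Omega R} {L : Omega -> nat -> nat -> 'F_2}
    (delta : Omega -> digits) {C : nat -> nat -> 'F_2} {k p q : nat} :
  digital_01_sequence C ->
  (forall w, unit_lower_triangular (L w)) -> uniform_corners P L ->
  (q * 2 ^ k <= p)%N ->
  exists A : set Omega, [/\ measurable A, (P A <= (3 / 2 ^+ q)%:E)%E &
    forall w, ~ A w -> ((2 ^+ k / 2)%:E <=
      mesh_ratio (scrambled_sequence R C (L w) (delta w))
        (2 ^ (p + q * 2 ^ k)))%E].
Proof.
move=> hC uL cL pq; have [K net] := digital_01_sequence_net C (p + q * 2 ^ k) k hC.
have := uniform_corners_bound _ [pred X | ~~ carrying (reduced_block K X)] (2 ^ q) 3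
  uL cL _ (card_unitri_not_carrying k p q K pq).
rewrite expn_gt0 natrX => /(_ isT)[mA PA]; eexists; split; [exact: mA|exact: PA|].
move=> w /= /negP; rewrite negbK => good.
have [n [n' [j [nm n'm jm eqj [xj x'j x1 x0]]]]] :=
  carrying_neighbours C (L w) (delta w) k p (q * 2 ^ k) K net (uL w) good.
apply: (@mesh_ratio_ge _ _ _ _ n n') => //.
  by apply/eqP => nn'; move: xj; rewrite nn' x'j.
apply: (digital_point_carry _ _ _ j) => //.
exact: ltn_addr.
Qed.

(** Borel-Cantelli; the partial sums of [3 / 2 ^ floor (r / 2)] telescope
    against the exact tail given by [sum]. *)
Lemma ae_eventually_half {d} {Omega : measurableType d} {R : realType}
    (P : probability Omega R) (A : nat -> set Omega) :
  (forall r, measurable (A r)) ->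
  (forall r, (P (A r) <= (3 / 2 ^+ r./2)%:E)%E) ->
  {ae P, forall w, \forall r \near \oo, ~ A r w}.
Proof.
move=> mA PA.
have sum n : \sum_(0 <= r < n) 3 / 2 ^+ r./2
    <= 12 - (if odd n then 9 else 12) / 2 ^+ n./2 :> R.
  elim: n => [|n IH]; first by rewrite big_nil /= expr0 divr1 subrr.
  rewrite big_nat_recr //= uphalf_half.
  apply: le_trans (lerD IH (lexx _)) _.
  case: (odd n); rewrite /= ?add0n ?add1n ?exprS ?invfM.
    by move: (2 ^- n./2) => t; lra.
  by move: (2 ^- n./2) => t; lra.
exists (lim_sup_set A); split.
- apply: bigcap_measurable => // n _.
  by apply: bigcup_measurable => j _; exact: mA.
- apply: lim_sup_set_cvg0 => //.
  apply: (@le_lt_trans _ _ 12%:E); last exact: ltry.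
  apply: lime_le; first exact: is_cvg_nneseries.
  apply: nearW => n; apply: (@le_trans _ _ (\sum_(0 <= r < n) (3 / 2 ^+ r./2)%:E)%E).
    by apply: lee_sum => i _; exact: PA.
  rewrite sumEFin lee_fin; apply: le_trans (sum n) _.
  by rewrite gerBl; case: odd; rewrite divr_ge0// exprn_ge0.
- move=> w /= nfar n _; apply: contrapT => notA; apply: nfar.
  exists n => // r /= nr Ar; apply: notA; by exists r.
Qed.

(** For [r > 0], [2 ^ k] is the largest power of [2] that is at most [r ^ eps];
    since [r * 2 ^ k <= r ^ (1 + eps)], the carry positions take at most half of
    the [m] leading digits and the others stay free. *)
Lemma sparse_index_split {R : realType} {eps : R} (r : nat) : 0 < eps ->
  exists k p, [/\ sparse_index eps r = (2 ^ (p + r./2 * 2 ^ k))%N,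
    (r./2 * 2 ^ k <= p)%N & (0 < r)%N -> r%:R `^ eps / 2 <= 2 ^+ k].
Proof.
move=> e0; case: r => [|r'].
  exists 0%N, 0%N; split => //.
  by rewrite /sparse_index powR0 ?ceil0// gt_eqF// addr_gt0.
set r := r'.+1; set a : R := r%:R `^ eps.
have r1 : 1 <= r%:R :> R by rewrite ler1n.
have a1 : 1 <= a.
  have -> : 1 = 1 `^ eps by rewrite powR1.
  by apply: ge0_ler_powR => //; rewrite ?nnegrE ?ler0n // ltW.
have a0 : 0 <= a by rewrite (le_trans ler01).
pose t := Num.truncn a; pose k := trunc_log 2 t.
have t0 : (0 < t)%N by rewrite truncn_gt0.
have /andP[ta at1] := truncn_itv a0; rewrite -/t in ta at1.
set m := `|Num.ceil (r%:R `^ (1 + eps))|%N.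
have ka : (2 ^ k)%N%:R <= a.
  by rewrite (le_trans _ ta)// ler_nat trunc_logP.
have rm : (r * 2 ^ k <= m)%N.
  rewrite -(ler_nat R) natr_absz ger0_norm; last first.
    by rewrite ceil_ge0 (lt_le_trans _ (powR_ge0 _ _))// ltrN10.
  apply: le_trans (ceil_ge _).
  rewrite powRD; last by rewrite (gt_eqF (lt_le_trans ltr01 r1)) implybT.
  by rewrite powRr1 ?(le_trans ler01)// natrM ler_pM.
have qm : (r./2 * 2 ^ k + r./2 * 2 ^ k <= m)%N.
  apply: leq_trans rm; rewrite -mulnDl leq_mul2r addnn.
  by rewrite -[leqRHS]odd_double_half leq_addl orbT.
exists k, (m - r./2 * 2 ^ k)%N; split.
- by rewrite subnK// (leq_trans _ qm)// leq_addl.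
- by rewrite leq_subRL// (leq_trans _ qm)// leq_addl.
- move=> _; rewrite ler_pdivrMr// -natrX -natrM.
  apply: le_trans (ltW at1) _.
  by rewrite ler_nat mulnC -expnS trunc_log_ltn.
Qed.

(** This bound without logarithm is what gives all three assertions: the
    logarithm is eventually at least [1]. *)
Lemma ae_mesh_ratio_ge {d} {Omega : measurableType d} {R : realType}
    {P : probability Omega R} {L : Omega -> nat -> nat -> 'F_2}
    (delta : Omega -> digits) {C : nat -> nat -> 'F_2} {eps : R} :
  digital_01_sequence C ->
  (forall w, unit_lower_triangular (L w)) -> uniform_corners P L ->
  0 < eps ->
  {ae P, forall w, \forall r \near \oo, ((r%:R `^ eps / 4)%:E <=
    mesh_ratio (scrambled_sequence R C (L w) (delta w))
      (sparse_index eps r))%E}.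
Proof.
move=> hC uL cL e0.
have /boolp.choice[A hA] : forall r : nat, exists A : set Omega,
    [/\ measurable A, (P A <= (3 / 2 ^+ r./2)%:E)%E &
      forall w, ~ A w -> (0 < r)%N -> ((r%:R `^ eps / 4)%:E <=
        mesh_ratio (scrambled_sequence R C (L w) (delta w))
          (sparse_index eps r))%E].
  move=> r; have [k [p [-> pq rk]]] := sparse_index_split r e0.
  have [A [mA PA hA]] := large_mesh_ratio delta hC uL cL pq.
  exists A; split => // w /hA le r0; apply: le_trans le.
  by rewrite lee_fin; have := rk r0; lra.
have mA r : measurable (A r) by have [] := hA r.
have PA r : (P (A r) <= (3 / 2 ^+ r./2)%:E)%E by have [] := hA r.
apply: filterS (ae_eventually_half P A mA PA) => w.
apply: filterS2 (nbhs_infty_ge 1) => r r0 nA.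
by have [_ _] := hA r; apply.
Qed.

Theorem corollary5p13 (R : realType) (d : measure_display)
  (Omega : measurableType d) (P : probability Omega R)
  (C : nat -> nat -> 'F_2) (L : Omega -> nat -> nat -> 'F_2)
  (delta : Omega -> digits)
  (hC : digital_01_sequence C)
  (hscr : matrix_scrambling P L delta \/ linear_scrambling P L delta) :
  [/\ forall eps : R, 0 < eps ->
        {ae P, forall w, \forall r \near \oo,
          ((r%:R `^ eps / (8 * ln (2 + r%:R) ^+ 2))%:E <=
           mesh_ratio (scrambled_sequence R C (L w) (delta w))
                      (sparse_index eps r))%E},
      forall eps : R, 0 < eps ->
        {ae P, forall w,
          mesh_ratio (scrambled_sequence R C (L w) (delta w))
                     (sparse_index eps r) @[r --> \oo] --> +oo%E} &
      {ae P, forall w,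
        ~ quasi_uniform (scrambled_sequence R C (L w) (delta w))}].
Proof.
have [uL cL] := scrambling_uniform_corners P L delta hscr.
have ratio (eps : R) (e0 : 0 < eps) := ae_mesh_ratio_ge delta hC uL cL e0.
have diverge (eps : R) : 0 < eps -> {ae P, forall w,
    mesh_ratio (scrambled_sequence R C (L w) (delta w))
               (sparse_index eps r) @[r --> \oo] --> +oo%E}.
  move=> e0; apply: filterS (ratio eps e0) => w rw; apply/cvgeyPge => M.
  (* [4 * M <= r ^ eps] holds once [r >= (4 * M) ^ (1 / eps)]; the maximum with
     [0] makes the real power meaningful for negative [M]. *)
  have [N MN] : exists N : nat, (Num.max 0 (4 * M)) `^ eps^-1 <= N%:R.
    exists (Num.bound ((Num.max 0 (4 * M)) `^ eps^-1)).
    by apply/ltW/archi_boundP/powR_ge0.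
  apply: filterS2 (nbhs_infty_ge N) rw => r Nr; apply: le_trans.
  have M0 : 0 <= Num.max 0 (4 * M) by rewrite le_max lexx.
  rewrite lee_fin ler_pdivlMr// mulrC.
  apply: (@le_trans _ _ (Num.max 0 (4 * M))); first by rewrite le_max lexx orbT.
  have -> : Num.max 0 (4 * M) = (Num.max 0 (4 * M) `^ eps^-1) `^ eps.
    by rewrite -powRrM mulVf ?powRr1// gt_eqF.
  apply: ge0_ler_powR; rewrite ?nnegrE ?powR_ge0 ?ler0n ?(ltW e0)//.
  by rewrite (le_trans MN)// ler_nat.
split => // [eps e0|].
  apply: filterS (ratio eps e0) => w.
  (* For [r >= e] the logarithm is at least [1], so that
     [8 * ln (2 + r) ^ 2 >= 4]. *)
  have [N eN] : exists N : nat, expR 1 <= N%:R :> R.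
    by exists (Num.bound (expR 1 : R)); apply/ltW/archi_boundP/expR_ge0.
  apply: filterS2 (nbhs_infty_ge N) => r Nr; apply: le_trans.
  have ln1 : 1 <= ln (2 + r%:R : R).
    rewrite -[leLHS]expRK ler_ln ?posrE ?expR_gt0 ?ltr_wpDr//.
    by rewrite (le_trans eN)// (@le_trans _ _ r%:R) ?ler_nat// lerDr.
  rewrite lee_fin ler_wpM2l ?powR_ge0// lef_pV2 ?posrE//.
    have : 1 <= ln (2 + r%:R : R) ^+ 2 by rewrite exprn_ege1.
    lra.
  by rewrite mulr_gt0// exprn_gt0// (lt_le_trans ltr01).
apply: filterS (diverge 1 ltr01) => w /cvgeyPgt/= div; rewrite /quasi_uniform.
set s := ereal_sup _ => slt.
have le r : (0 < r)%N ->
    (mesh_ratio (scrambled_sequence R C (L w) (delta w)) (sparse_index (1 : R) r) <= s)%E.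
  move=> r0; apply: ereal_sup_ubound; exists (sparse_index (1 : R) r) => //=.
  rewrite /sparse_index -{1}(expn1 2) leq_exp2l// absz_gt0 gt_eqF//.
  by rewrite ceil_gt0 powR_gt0 ?ltr0n.
have sfine : (s <= (fine s)%:E)%E.
  by case: (s) slt => [x|//|] //= _; rewrite leNye.
have [N _ hN] := div (fine s).
have := hN N.+1 (leqnSn N); rewrite /= ltNge.
by rewrite (le_trans (le N.+1 (ltn0Sn N)) sfine).
Qed.
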